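(* Let $p\ge 2$, $1\le q\le p$ and $n\ge 6(p^2+2p)$. Then $$ar(K_n,S_{p,q})=\begin{cases}\left\lfloor\frac{(p-1)n}{2}\right\rfloor+1, & 1\le q\le p-1,\\[2pt] \left\lfloor\frac{p(n-1)}{2}\right\rfloor+1, & q=p.\end{cases}$$
   Context: For $p\ge q\ge 1$, the double star $S_{p,q}$ is the tree obtained from the stars $K_{1,p}$ and $K_{1,q}$ (vertex-disjoint) by adding an edge joining their centers; it has $p+q$ leaves. A subgraph of an edge-colored graph is rainbow if all its edges receive distinct colors. For a graph $G$, $ar(K_n,G)$ is the maximum number of colors in an edge-coloring of $K_n$ containing no rainbow copy of $G$. *)

(* Defs.v *)
From mathcomp Require Import all_boot.

Set Implicit Arguments.
Unset Strict Implicit.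
Unset Printing Implicit Defensive.

Record sgraph := SGraph {
  svertex :> finType;
  sedge : rel svertex;
  sedge_sym : symmetric sedge;
  sedge_irr : irreflexive sedge }.

Definition edges (G : sgraph) : {set {set G}} :=
  [set [set x; y] | x in predT, y in sedge x].

Lemma in_edges (G : sgraph) (x y : G) : ([set x; y] \in edges G) = sedge x y.
Proof.
apply/imset2P/idP => [[a b _ ab E]|xy]; last by exists x y.
have {}ab : sedge a b := ab.
have nab : a != b by apply: contraTneq ab => ->; rewrite sedge_irr.
have xE : x \in [set a; b] by rewrite -E set21.
have yE : y \in [set a; b] by rewrite -E set22.
have xy : x != y.
  apply: contraNneq nab => xy; move: (set21 a b) (set22 a b).
  by rewrite -E xy setUid !inE => /eqP-> /eqP->.
case/set2P: xE xy => ->; case/set2P: yE => ->; rewrite ?eqxx //.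
by rewrite sedge_sym.
Qed.

Definition complete_rel (n : nat) : rel 'I_n := fun x y => x != y.

Lemma complete_sym n : symmetric (@complete_rel n).
Proof. by move=> x y; rewrite /complete_rel eq_sym. Qed.

Lemma complete_irr n : irreflexive (@complete_rel n).
Proof. by move=> x; rewrite /complete_rel eqxx. Qed.

Definition complete (n : nat) : sgraph :=
  SGraph (@complete_sym n) (@complete_irr n).

(* The star K_{1,p}, with centre ord0. *)
Definition star_rel (p : nat) : rel 'I_p.+1 :=
  fun x y => (x == ord0) (+) (y == ord0).

Lemma star_sym p : symmetric (@star_rel p).
Proof. by move=> x y; rewrite /star_rel addbC. Qed.

Lemma star_irr p : irreflexive (@star_rel p).
Proof. by move=> x; rewrite /star_rel addbb. Qed.

Definition star (p : nat) : sgraph := SGraph (@star_sym p) (@star_irr p).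

Definition double_star_rel (p q : nat) : rel (star p + star q)%type :=
  fun u v => match u, v with
  | inl x, inl y => sedge x y
  | inr x, inr y => sedge x y
  | inl x, inr y | inr y, inl x => (x == ord0) && (y == ord0)
  end.

Lemma double_star_sym p q : symmetric (@double_star_rel p q).
Proof.
by case=> [x|x] [y|y] //; [exact: (@star_sym p) | exact: (@star_sym q)].
Qed.

Lemma double_star_irr p q : irreflexive (@double_star_rel p q).
Proof. by case=> x; [exact: (@star_irr p) | exact: (@star_irr q)]. Qed.

Definition double_star (p q : nat) : sgraph :=
  SGraph (@double_star_sym p q) (@double_star_irr p q).

(* An edge-colouring of H is a function on {set H}; only its values on
   edges H are ever used. *)

(* A copy of G in H is the image of an injective homomorphism f : G -> H; it
   need not be induced. *)
Definition is_copy (G H : sgraph) (f : {ffun G -> H}) : bool :=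
  injectiveb f && [forall x, forall y, sedge x y ==> sedge (f x) (f y)].

Definition rainbow (G H : sgraph) (C : eqType) (c : {set H} -> C)
    (f : {ffun G -> H}) : bool :=
  [forall e in edges G, forall e' in edges G,
     (c (f @: e) == c (f @: e')) ==> (f @: e == f @: e')].

Definition has_rainbow_copy (G H : sgraph) (C : eqType) (c : {set H} -> C) :
    bool :=
  [exists f : {ffun G -> H}, is_copy f && rainbow c f].

(* Taking the colours in {set H} is no restriction, since a colouring uses at
   most #|edges H| colours; see ar_max. The maximum is 0 if every colouring of
   H has a rainbow copy of G. *)
Definition ar (H G : sgraph) : nat :=
  \max_(c : {ffun {set H} -> {set H}} | ~~ has_rainbow_copy G c)
     #|c @: edges H|.

Lemma rainbow_eq (G H : sgraph) (C D : eqType) (c : {set H} -> C)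
    (d : {set H} -> D) :
  {in edges H &, forall e e', (c e == c e') = (d e == d e')} ->
  has_rainbow_copy G c = has_rainbow_copy G d.
Proof.
move=> cd; apply: eq_existsb => f; have [/andP[_ /forallP fh]|//] := boolP (is_copy f).
have fE e : e \in edges G -> f @: e \in edges H.
  case/imset2P=> x y _ xy ->; rewrite imsetU1 imset_set1.
  by apply: imset2_f => //; have /forallP/(_ y)/implyP := fh x; apply.
apply: eq_forallb => e; case: (boolP (e \in _)) => //= eE.
apply: eq_forallb => e'; case: (boolP (e' \in _)) => //= eE'.
by rewrite cd ?fE.
Qed.

Lemma recolour (H G : sgraph) (C : finType) (c : {set H} -> C) :
  ~~ has_rainbow_copy G c ->
  exists2 d : {ffun {set H} -> {set H}},
    ~~ has_rainbow_copy G d & #|d @: edges H| = #|c @: edges H|.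
Proof.
move=> nc; pose r a := odflt set0 [pick e in edges H | c e == a].
have cr e : e \in edges H -> c (r (c e)) = c e.
  move=> eE; rewrite /r; case: pickP => [e' /andP[_ /eqP]//|/(_ e)].
  by rewrite /= eE eqxx.
have rI : {in c @: edges H &, injective r}.
  by move=> _ _ /imsetP[e eE ->] /imsetP[e' eE' ->] /(congr1 c); rewrite !cr.
exists [ffun e => r (c e)].
  rewrite (@rainbow_eq _ _ _ _ _ c) // => e e' eE eE'; rewrite !ffunE.
  by apply: (inj_in_eq rI); apply: imset_f.
rewrite -(card_in_imset rI) -imset_comp.
by congr #|pred_of_set _|; apply: eq_imset => e; rewrite ffunE.
Qed.

Lemma ar_max (H G : sgraph) (C : finType) (c : {set H} -> C) :
  ~~ has_rainbow_copy G c -> #|c @: edges H| <= ar H G.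
Proof.
move=> /recolour[d nd <-].
exact: (@leq_bigmax_cond _ (fun d : {ffun {set H} -> {set H}} =>
  ~~ has_rainbow_copy G d) (fun d => #|d @: edges H|)).
Qed.

Lemma ar_attained (H G : sgraph) (C : finType) (c0 : {set H} -> C) :
  ~~ has_rainbow_copy G c0 ->
  exists2 c : {ffun {set H} -> {set H}},
    ~~ has_rainbow_copy G c & #|c @: edges H| = ar H G.
Proof.
move=> /recolour[d nd _].
pose P : pred {ffun {set H} -> {set H}} := fun c => ~~ has_rainbow_copy G c.
have P0 : 0 < #|P| by apply/card_gt0P; exists d.
pose F (c : {ffun {set H} -> {set H}}) := #|c @: edges H|.
by have [c Pc E] := eq_bigmax_cond F P0; exists c.
Qed.

(* Main.v *)
Require Import Defs.
From mathcomp Require Import all_boot zify.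

Set Implicit Arguments.
Unset Strict Implicit.
Unset Printing Implicit Defensive.

(* Write P(x) for the set of colours at x and k for the number of colours. A
   rainbow S_{p,q} needs p+1 colours at one centre and q+1 at the other.

   Lower bound: give pairwise distinct colours to the edges of an almost
   (p-1)-regular graph (if q < p), or of a dominating vertex joined to an almost
   (p-2)-regular graph (if q = p), and one further colour to all other edges.
   Then no vertex, respectively at most one vertex, sees p+1 colours.

   Upper bound, for a colouring without a rainbow S_{p,q}:
   - If |P(v)| > 3p for some v, then |P(x)| <= q for every x <> v, since one
     could otherwise choose q edges at x and then p edges at v greedily. This
     forces 2k <= q(n-1) + 2.
   - If |P(x)| <= p for all x, then 2k <= (p-1)n + 2.
   - Otherwise all |P(x)| are at most 3p, and some x has p+1 edges of distinct
     colours, with ends B. A vertex y outside B and x sees fewer than q colours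
     outside P(x) on edges avoiding B and x, so 2k <= (q-1)n + O(p^2).
   In the first two cases 2k falls short of the sum of the |P(x)| by about n:
   with M_c the number of vertices that see the colour c, the weights M_c - 2 of
   the colours at a vertex add up to nearly n, so on average a colour is seen by
   nearly all vertices; a vertex missing it would double the total weight. *)

(** * Colours at the vertices of a coloured complete graph *)

Lemma sum_card_exchange (I J : finType) (D : {set I}) (S : I -> {set J})
    (Q : {set J}) :
  \sum_(i in D) #|S i :&: Q| = \sum_(j in Q) #|[set i in D | j \in S i]|.
Proof.
under eq_bigr => i _ do rewrite -sum1_card.
under [RHS]eq_bigr => j _ do rewrite -sum1_card.
rewrite (exchange_big_dep (mem Q)) /=; last by move=> i j _ /setIP[].
apply: eq_bigr => j jQ; apply: eq_bigl => i.
by rewrite !inE jQ andbT.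
Qed.

(* Some c0 is seen by more than t points of Y, by averaging with weights w; if a
   point of Y misses c0, its own weight t adds up with that of c0. *)
Lemma card_le_sum_weights (I J : finType) (Y : {set I}) (R : {set J})
    (S : I -> {set J}) (w : J -> nat) t :
  (forall y, y \in Y -> S y \subset R) ->
  (forall y, y \in Y -> t <= \sum_(c in S y) w c) ->
  (forall c, c \in R -> #|[set y in Y | c \in S y]| <= w c + 2) ->
  #|Y| <= 2 * t + 1 ->
  #|Y| <= \sum_(c in R) w c + 2.
Proof.
move=> SR tS Mw tY; rewrite leqNgt; apply/negP => ltW.
set W := \sum_(c in R) w c in ltW *.
pose M c := #|[set y in Y | c \in S y]|.
have dc : \sum_(y in Y) \sum_(c in S y) w c = \sum_(c in R) w c * M c.
  rewrite (exchange_big_dep (mem R)) /=; last first.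
    by move=> y c yY; apply/subsetP/SR.
  apply: eq_bigr => c _; rewrite mulnC /M -sum_nat_const.
  by apply: eq_bigl => y; rewrite inE.
have lb : #|Y| * t <= \sum_(c in R) w c * M c.
  by rewrite -dc -sum_nat_const; apply: leq_sum => y /tS.
have [c0 c0R tM] : exists2 c0, c0 \in R & t < M c0.
  apply/exists_inP; apply: contraTT lb => /exists_inPn small.
  rewrite -ltnNge; apply: (@leq_ltn_trans (W * t)).
    rewrite /W big_distrl; apply: leq_sum => c cR.
    by rewrite leq_mul2l leqNgt (negPf (small c cR)) orbT.
  by rewrite ltn_pmul2r; lia.
have w0W : w c0 <= W by rewrite /W (bigD1 c0) //= leq_addr.
have := Mw c0 c0R; rewrite -/(M c0) => Mw0.
have [/subsetP sub|/subsetPn[y yY]] := boolP (Y \subset [set y in Y | c0 \in S y]).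
  have : #|Y| <= M c0 by apply/subset_leq_card/subsetP.
  lia.
rewrite inE yY /= => c0S.
have : w c0 + \sum_(c in S y) w c <= W.
  rewrite /W [leqRHS](bigD1 c0) //= leq_add2l [leqRHS](bigID (mem (S y))) /=.
  apply: leq_trans (leq_addr _ _); apply: eq_leq; apply: eq_bigl => c.
  apply/idP/idP => [cS|/andP[]//].
  rewrite cS (subsetP (SR y yY)) //= andbT.
  by apply: contraNneq c0S => <-.
(* As [t < M c0 <= w c0 + 2], the two weights give [2 * t - 1 <= W], against
   [W + 2 < #|Y| <= 2 * t + 1]. *)
have := tS y yY; lia.
Qed.

Lemma transversal_seq (V C : finType) (h : V -> C) (Z : {set V}) r :
  r <= #|h @: Z| ->
  exists s : seq V, [/\ size s = r, {subset s <= Z} & uniq (map h s)].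
Proof.
elim: r => [|r IH] rZ; first by exists [::].
have [s [ss sZ us]] := IH (ltnW rZ).
have [a aZ as_] : exists2 a, a \in h @: Z & a \notin map h s.
  apply/subsetPn; apply: contraTN rZ => /subset_leq_card le.
  by rewrite -leqNgt (leq_trans le) // (leq_trans (card_size _)) // size_map ss.
have /imsetP[z zZ az] := aZ; exists (z :: s); split => /=.
- by rewrite ss.
- by move=> y /predU1P[->|/sZ].
- by rewrite -az as_.
Qed.

Section Colouring.
Variables (V C : finType) (g : V -> V -> C).
Hypothesis gC : forall x y, g x y = g y x.

Definition colours_at x := [set g x y | y in predC1 x].
Definition all_colours := [set g x y | x in predT, y in predC1 x].

Local Notation P := colours_at.
Local Notation K := all_colours.

Lemma mem_colours_at x y : x != y -> g x y \in P x.
Proof. by move=> xy; apply: imset_f; rewrite !inE eq_sym. Qed.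

Lemma colours_at_sub x : P x \subset K.
Proof. by apply/subsetP => _ /imsetP[y xy ->]; apply: imset2_f. Qed.

Lemma all_coloursP a : reflect (exists x y, x != y /\ a = g x y) (a \in K).
Proof.
apply: (iffP imset2P) => [[x y _ yx ->]|[x [y [xy ->]]]].
  by exists x, y; split => //; rewrite eq_sym.
by exists x y => //; rewrite inE eq_sym.
Qed.

Section Restricted.
Variable D : {set V}.

(* The multiplicity only counts vertices of D, but the colours at such a vertex
   include those of its edges leaving D. *)
Definition mult a := #|[set x in D | a \in P x]|.
Definition repeated := [set a in K | 1 < mult a].

Lemma mult_ge2 x y : x \in D -> y \in D -> x != y -> 1 < mult (g x y).
Proof.
move=> xD yD xy; apply: leq_trans (_ : #|[set x; y]| <= _).
  by rewrite cards2 xy.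
apply/subset_leq_card/subsetP => z /set2P[]->; rewrite inE ?xD ?yD /=.
  exact: mem_colours_at.
by rewrite gC mem_colours_at // eq_sym.
Qed.

Lemma sum_mult : \sum_(a in K) mult a = \sum_(x in D) #|P x|.
Proof.
rewrite -sum_card_exchange; apply: eq_bigr => x _.
by rewrite (setIidPl (colours_at_sub x)).
Qed.

(** Every other [z] in [D] shares the colour of [yz] with [y], and this colour is repeated. A
    repeated colour [a] at [y] accounts for at most [mult a - 1] such [z]. *)
Lemma repeated_cover y : y \in D ->
  #|D| <= \sum_(a in P y :&: repeated) (mult a - 2) + #|P y :&: repeated| + 1.
Proof.
move=> yD; set Q := P y :&: repeated.
have lb : #|D :\ y| <= \sum_(z in D :\ y) #|P z :&: Q|.
  rewrite -sum1_card; apply: leq_sum => z /setD1P[zy zD].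
  apply/card_gt0P; exists (g y z).
  rewrite !inE gC mem_colours_at // gC mem_colours_at 1?eq_sym //=.
  rewrite mult_ge2 1?eq_sym // andbT.
  by apply/(subsetP (colours_at_sub y))/mem_colours_at; rewrite eq_sym.
rewrite (cardsD1 y D) yD addnC leq_add2r (leq_trans lb) // sum_card_exchange.
rewrite -sum1_card -big_split /=; apply: leq_sum => a /setIP[ay /setIdP[_ a2]].
suff : #|[set x in D :\ y | a \in P x]| < mult a by lia.
rewrite [ltnRHS](cardsD1 y) inE yD ay ltnS.
by apply/subset_leq_card/subsetP => z; rewrite !inE -andbA.
Qed.

Lemma sum_repeated :
  \sum_(a in repeated) (mult a - 2) + 2 * #|repeated| =
  \sum_(a in repeated) mult a.
Proof.
rewrite mulnC -sum_nat_const -big_split; apply: eq_bigr => a /setIdP[_ a2] /=.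
by lia.
Qed.
End Restricted.

(** For [D] all of [V] every colour is repeated, so the weights [mult a - 2] add up to the sum of
    the [#|P x|] less [2 * #|K|]; by averaging they add up to at least [#|V| - 2]. *)
Lemma bounded_colours p : #|V| >= 2 * p + 1 -> (forall x, #|P x| <= p) ->
  2 * #|K| + #|V| <= p * #|V| + 2.
Proof.
move=> pV Pp; pose R := repeated setT.
have RK : R = K.
  apply/setP=> a; rewrite inE andbC; case: all_coloursP => [|_];
    last by rewrite andbF.
  by move=> [x [y [xy ->]]]; rewrite mult_ge2 ?inE.
have W : #|[set: V]| <= \sum_(a in R) (mult setT a - 2) + 2.
  apply: (@card_le_sum_weights _ _ _ R P _ (#|V| - 1 - p)) => [y _|y _|a|].
  - by rewrite RK colours_at_sub.
  - have := repeated_cover (in_setT y); rewrite -/R RK.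
    by rewrite (setIidPl (colours_at_sub y)) cardsT; have := Pp y; lia.
  - by rewrite inE => /andP[_]; rewrite -/(mult setT a); lia.
  - by rewrite cardsT; lia.
rewrite cardsT in W; have := sum_repeated setT; rewrite -/R {2 3}RK sum_mult.
have : \sum_(x in [set: V]) #|P x| <= p * #|V|.
  by rewrite mulnC -cardsT -sum_nat_const; apply: leq_sum.
by lia.
Qed.

(* With D the complement of v, a colour of multiplicity less than 2 occurs only
   on one edge vy; the set Y of these y compensates for the missing weight. *)
Lemma bounded_colours_but1 q v : 0 < q -> 2 * q <= #|V| ->
  (forall x, x != v -> #|P x| <= q) -> 2 * #|K| <= q * (#|V| - 1) + 2.
Proof.
move=> q0 qV Pq; pose D := [set~ v]; pose R := repeated D.
have cD : #|D| = #|V| - 1 by rewrite cardsC1 subn1.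
pose Y := [set y in D | g v y \notin R].
have DY y : y \in D -> y != v by rewrite !inE.
have K1 : #|K :\: R| <= #|Y|.
  suff /subset_leq_card/leq_trans : K :\: R \subset g v @: Y.
    by apply; apply: leq_imset_card.
  apply/subsetP => a /setDP[/all_coloursP[x [y [xy ->]]] nR].
  have [xv|xv] := eqVneq x v.
    by subst x; apply: imset_f; apply/setIdP; rewrite in_setC1 eq_sym.
  have [yv|yv] := eqVneq y v.
    subst y; rewrite gC in nR *; apply: imset_f; apply/setIdP.
    by rewrite in_setC1.
  case/negP: nR; rewrite inE mult_ge2 ?inE // andbT.
  exact: (subsetP (colours_at_sub x)) (mem_colours_at xy).
have W : #|Y| <= \sum_(a in R) (mult D a - 2) + 2.
  (* For [y] in [Y] the colour of [vy] is not repeated, so [y] sees at most [q - 1] repeated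
     colours; hence the threshold [#|D| - q]. *)
  apply: (@card_le_sum_weights _ _ Y R (fun y => P y :&: R) _ (#|D| - q))
    => [y _|y|a|].
  - exact: subsetIr.
  - rewrite inE => /andP[yD nR]; have := repeated_cover yD; rewrite -/R.
    have : #|P y :&: R| < #|P y|.
      apply/proper_card/properP; split; first exact: subsetIl.
      exists (g v y); first by rewrite gC mem_colours_at ?DY.
      by rewrite inE (negPf nR) andbF.
    by have := Pq y (DY y yD); lia.
  - move=> aR; suff : #|[set y in Y | a \in P y :&: R]| <= mult D a by lia.
    apply/subset_leq_card/subsetP => y; rewrite !inE.
    by move=> /andP[/andP[-> _] /andP[->]].
  - have : #|Y| <= #|D| by apply/subset_leq_card/subsetP => y /setIdP[].
    by lia.
have RK : R \subset K by apply/subsetP => a /setIdP[].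
have := sum_repeated D; rewrite -/R.
have : \sum_(x in D) #|P x| <= q * (#|V| - 1).
  by rewrite mulnC -cD -sum_nat_const; apply: leq_sum => x /DY/Pq.
rewrite -sum_mult (big_setID R) /= (setIidPr RK).
(* A colour outside [R] counts once here and once through [Y], a colour in [R] twice by
   [sum_repeated]. *)
have : #|K :\: R| <= \sum_(a in K :\: R) mult D a.
  rewrite -sum1_card; apply: leq_sum => a /setDP[/all_coloursP[x [y [xy ->]]] _].
  apply/card_gt0P; have [xv|xv] := eqVneq x v.
    exists y; apply/setIdP; rewrite in_setC1 -xv eq_sym gC.
    by split; rewrite // mem_colours_at // eq_sym.
  by exists x; rewrite !inE xv mem_colours_at.
have := cardsID R K; rewrite (setIidPr RK).
by lia.
Qed.


(** * Rainbow double stars and the upper bound *)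

Definition rainbow_double_star p q := exists x y (s t : seq V),
  [/\ size s = p, size t = q, uniq (x :: y :: s ++ t) &
      uniq (g x y :: map (g x) s ++ map (g y) t)].

(* The predicate A separates the colours of the two stars. *)
Lemma uniq_double_star x y (s t : seq V) (A : pred C) :
  x != y -> uniq (map (g x) s) -> uniq (map (g y) t) ->
  (forall z, z \in s -> [/\ z != x, g x z != g x y & A (g x z)]) ->
  (forall z, z \in t -> [/\ z != y, g y z != g x y, ~~ A (g y z) & z \notin s]) ->
  uniq (x :: y :: s ++ t) /\ uniq (g x y :: map (g x) s ++ map (g y) t).
Proof.
move=> xy us ut sP tP; split.
  rewrite !cons_uniq inE negb_or xy !mem_cat !negb_or cat_uniq.
  rewrite (map_uniq us) (map_uniq ut) /= andbT -!andbA; apply/and5P; split.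
  - by apply/negP => /sP[]; rewrite eqxx.
  - by apply/negP => /tP[_]; rewrite gC eqxx.
  - by apply/negP => /sP[_]; rewrite eqxx.
  - by apply/negP => /tP[]; rewrite eqxx.
  - by apply/hasPn => z /tP[].
rewrite cons_uniq cat_uniq us ut mem_cat negb_or andbT -!andbA; apply/and3P; split.
- by apply/mapP => -[z /sP[_ zy _] E]; rewrite -E eqxx in zy.
- by apply/mapP => -[z /tP[_ zy _ _] E]; rewrite -E eqxx in zy.
- apply/hasPn => _ /mapP[z /tP[_ _ nA _] ->]; apply/mapP => -[z' /sP[_ _ A'] E].
  by rewrite E A' in nA.
Qed.

(** Greedy choice: first [q] leaves [t] at [x], avoiding the colour of [vx], then [p] leaves at [v].
    The colours to avoid at [v] are the [1 + q] used ones and at most [q] on edges to [t]. *)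
Lemma colours_at_le_of_large p q v x : ~ rainbow_double_star p q -> x != v ->
  p + 2 * q < #|P v| -> #|P x| <= q.
Proof.
move=> nr xv Pv; rewrite leqNgt; apply/negP => Px; apply: nr.
have [|t [st tZ ut]] :=
    @transversal_seq _ _ (g x) [set z in predC1 x | g x z != g v x] q.
  suff : P x \subset g v x |: g x @: [set z in predC1 x | g x z != g v x].
    by move=> /subset_leq_card; rewrite cardsU1; lia.
  apply/subsetP => _ /imsetP[z zx ->]; rewrite !inE.
  have [//|ne] := eqVneq (g x z) (g v x).
  by apply: imset_f; rewrite inE zx.
pose bad := g v x :: map (g x) t.
(* The colour of [vx] lies in [bad], which keeps [x] out of [Z]. *)
pose Z := [set z in predC1 v | (g v z \notin bad) && (z \notin t)].
have [|s [ss sZ us]] := @transversal_seq _ _ (g v) Z p.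
  have : P v \subset [set a in bad ++ map (g v) t] :|: g v @: Z.
    apply/subsetP => _ /imsetP[z zv ->]; rewrite inE.
    case: (boolP (g v z \in g v @: Z)) => [|nZ]; first by rewrite orbT.
    rewrite orbF inE mem_cat; apply: contraNT nZ; rewrite negb_or => /andP[nb nt].
    apply: imset_f; rewrite inE zv nb /=.
    by apply: contra nt; apply: map_f.
  move=> /subset_leq_card/leq_trans/(_ (leq_card_setU _ _)).
  have : #|[set a in bad ++ map (g v) t]| <= 1 + q + q.
    rewrite cardsE (leq_trans (card_size _)) // size_cat /= !size_map st.
    by lia.
  by lia.
exists v, x, s, t.
have [|||z /sZ|z zt|] := @uniq_double_star v x s t (fun a => a \notin bad).
- by rewrite eq_sym.
- by [].
- by [].
- rewrite !inE => /and3P[zv nb zt]; split=> //.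
  by move: nb; rewrite negb_or => /andP[].
- have := tZ z zt; rewrite !inE => /andP[zx ne]; split=> //.
    by rewrite negbK map_f // orbT.
  by apply: contraL zt => /sZ; rewrite !inE => /and3P[].
by move=> u1 u2; split.
Qed.

(** [U] gathers the colours at [x] and at [B]. A colour outside [U] has all its edges inside [D], so
    it is counted in [Q] at both ends of an edge, and each [Q y] has fewer than [q] elements. *)
Lemma all_colours_le_of_bounded p q d x :
  ~ rainbow_double_star p q -> p < #|P x| -> (forall y, #|P y| <= d) ->
  2 * #|K| <= 2 * d + 2 * ((p + 1) * (d - 1)) + (#|V| - (p + 2)) * (q - 1).
Proof.
move=> nr Px Pd.
(* One edge beyond [p], as one of them may have the colour of the edge [xy] between the centres. *)
have [|b [sb bx ub]] := @transversal_seq _ _ (g x) [set~ x] p.+1.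
  apply: leq_trans Px _; apply/subset_leq_card/imsetS/subsetP => z.
  by rewrite !inE.
have {}bx z : z \in b -> z != x by move=> /bx; rewrite in_setC1.
pose B := [set z in b]; pose D := ~: (x |: B).
have cD : #|D| = #|V| - (p + 2).
  have := cardsC (x |: B); rewrite -/D cardsU1 inE cardsE.
  rewrite (card_uniqP (map_uniq ub)) sb.
  have -> : x \notin b by apply/negP => /bx; rewrite eqxx.
  by lia.
pose U := P x :|: \bigcup_(z in B) (P z :\: P x).
pose Q y := [set g y z | z in D & z != y] :\: P x.
(* Otherwise [y] takes [q] leaves in [D] by colours not at [x], and [x] takes [p] leaves in [B]. *)
have Qq y : y \in D -> #|Q y| <= q - 1.
  rewrite !inE negb_or => /andP[yx yB].
  suff : #|Q y| < q by lia.
  rewrite ltnNge; apply/negP => qQ; apply: nr.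
  have [|t [st tZ ut]] :=
      @transversal_seq _ _ (g y) [set z in D | (z != y) && (g y z \notin P x)] q.
    apply/(leq_trans qQ)/subset_leq_card/subsetP => _ /setDP[/imsetP[z zP ->] nP].
    by apply: imset_f; move: zP; rewrite !inE nP => /andP[-> ->].
  have [|s [ss sZ us]] := @transversal_seq _ _ (g x) [set z in B | g x z != g x y] p.
    have : g x @: B \subset g x y |: g x @: [set z in B | g x z != g x y].
      apply/subsetP => _ /imsetP[z zB ->]; rewrite inE in_set1.
      have [//|ne] := eqVneq (g x z) (g x y).
      by apply: imset_f; rewrite inE zB.
    move=> /subset_leq_card; rewrite cardsU1.
    have -> : #|g x @: B| = p.+1.
      rewrite -sb -(size_map (g x)) -(card_uniqP ub) -cardsE.
      apply: eq_card => a; rewrite inE.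
      apply/imsetP/mapP => -[z zb ->]; exists z => //; first by rewrite inE in zb.
      by rewrite inE.
    by lia.
  exists x, y, s, t.
  have [|||z /sZ|z zt|] := @uniq_double_star x y s t (fun a => a \in P x).
  - by rewrite eq_sym.
  - by [].
  - by [].
  - rewrite !inE => /andP[zb ne]; split=> //; first exact: bx.
    by apply: mem_colours_at; rewrite eq_sym bx.
  - have := tZ z zt; rewrite !inE negb_or -!andbA => /and4P[zx zb zy nP].
    split=> //.
      by apply: contraNneq nP => ->; apply: mem_colours_at; rewrite eq_sym.
    by apply: contra zb => /sZ; rewrite !inE => /andP[].
  by move=> u1 u2; split.
(* Each [z] in [B] shares the colour of [xz] with [x], hence [d - 1]. *)
have cU : #|U| <= d + (p + 1) * (d - 1).
  apply: leq_trans (leq_card_setU _ _) _; apply: leq_add => //.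
  apply: leq_trans (_ : \sum_(z in B) #|P z :\: P x| <= _).
    elim/big_ind2: _ => [|m1 A1 m2 A2 h1 h2|//]; first by rewrite cards0.
    by apply: leq_trans (leq_card_setU _ _) _; apply: leq_add.
  have -> : p + 1 = #|B| by rewrite cardsE (card_uniqP (map_uniq ub)) sb addn1.
  rewrite -sum_nat_const; apply: leq_sum => z; rewrite inE => /bx zx.
  suff : #|P z :\: P x| < #|P z| by have := Pd z; lia.
  apply/proper_card/properP; split; first exact: subsetDl.
  exists (g z x); first exact: mem_colours_at.
  by rewrite inE gC mem_colours_at // eq_sym.
have cKU : 2 * #|K :\: U| <= #|D| * (q - 1).
  apply: leq_trans (_ : \sum_(y in D) #|Q y :&: (K :\: U)| <= _); last first.
    rewrite -sum_nat_const; apply: leq_sum => y /Qq; apply: leq_trans.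
    exact/subset_leq_card/subsetIl.
  rewrite sum_card_exchange mulnC -sum_nat_const; apply: leq_sum => a.
  move=> /setDP[/all_coloursP[y [z [yz ->]]]].
  rewrite inE negb_or => /andP[nP /bigcupP nB].
  have inD u w : u != w -> g u w = g y z -> u \in D.
    move=> uw E; rewrite !inE negb_or; apply/andP; split.
      by apply: contraNneq nP => ux; rewrite -E ux mem_colours_at // -ux.
    apply/negP => ub'; apply: nB; exists u; first by rewrite inE.
    by rewrite inE nP -E mem_colours_at.
  have yD := inD y z yz erefl.
  have zD : z \in D by apply: (inD z y); rewrite 1?eq_sym.
  have -> : 2 = #|[set y; z]| by rewrite cards2 yz.
  apply/subset_leq_card/subsetP => u /set2P[]->; rewrite inE ?yD ?zD inE nP /=.
    by apply: imset_f; rewrite inE zD eq_sym.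
  by rewrite gC; apply: imset_f; rewrite inE yD.
have := cardsID U K; rewrite -cD.
have : #|K :&: U| <= #|U| by apply/subset_leq_card/subsetIr.
by lia.
Qed.

Lemma upper_bound p q : 2 <= p -> 0 < q <= p -> 6 * (p ^ 2 + 2 * p) <= #|V| ->
  ~ rainbow_double_star p q ->
  2 * #|K| <= (if q <= p - 1 then (p - 1) * #|V| else p * (#|V| - 1)) + 2.
Proof.
move=> p2 /andP[q0 qp] pV nr.
have [/existsP[v Pv]|/existsPn small] := boolP [exists v, 3 * p < #|P v|].
  have le1 : forall x, x != v -> #|P x| <= q.
    by move=> x xv; apply: (colours_at_le_of_large nr xv); lia.
  have qV : 2 * q <= #|V| by nia.
  by have := bounded_colours_but1 q0 qV le1; case: ifP; nia.
have [/existsP[x Px]|/existsPn le_p] := boolP [exists x, p < #|P x|].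
  have le3 y : #|P y| <= 3 * p by rewrite leqNgt.
  (* With [d = 3 * p] the terms without [#|V|] are at most [6 * p ^ 2 + 10 * p - 2]; the coefficient
     [q - 1] of [#|V|] is at least one below that of the goal. *)
  have := all_colours_le_of_bounded nr Px le3; case: ifP; nia.
have Vp : 2 * p + 1 <= #|V| by nia.
have Pp x : #|P x| <= p by rewrite leqNgt.
by have := bounded_colours Vp Pp; case: ifP; nia.
Qed.
End Colouring.

(** * Almost regular graphs *)

Lemma modn_wrap m a : a < 2 * m -> a %% m = if a < m then a else a - m.
Proof.
case: (ltnP a m) => [am _|ma am]; first by rewrite modn_small.
have am' : a - m < m by lia.
by rewrite -[in LHS](subnK ma) modnDr modn_small.
Qed.

Lemma set2_eq (T : finType) (a b a' b' : T) :
  [set a; b] = [set a'; b'] -> (a = a' /\ b = b') \/ (a = b' /\ b = a').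
Proof.
move=> E.
have /set2P[] : a \in [set a'; b'] by rewrite -E set21.
- move=> aa; left; split=> //; have := set22 a' b'; rewrite -E => /set2P[bb|//].
  have := set22 a b; rewrite E => /set2P[] ->; by rewrite ?bb ?aa.
- move=> ab; right; split=> //; have := set21 a' b'; rewrite -E => /set2P[bb|//].
  have := set22 a b; rewrite E => /set2P[] ->; by rewrite ?bb ?ab.
Qed.

Section NearRegular.
Variables (n m d : nat).
Hypotheses (mn : m <= n.+1) (dm : d + 2 <= m).

Local Notation h := (d./2).

(* The circulant joins i to i + 1, ..., i + d./2 modulo m, and for odd d also to
   i + m./2 for i < m./2 only, which makes the last chords a matching. The edges
   are numbered by k < (d * m)./2: the chord index is k %/ m, and i is k %% m. *)
Definition chord t := if t < h then t.+1 else m./2.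
Definition chord_end k := (k %% m + chord (k %/ m)) %% m.
Definition circulant_edge k : {set 'I_n.+1} :=
  [set inord (k %% m); inord (chord_end k)].
Definition circulant : {set {set 'I_n.+1}} :=
  [set circulant_edge k | k : 'I_((d * m)./2)].

(** [(d * m)./2] is [h * m] for even [d] and [h * m + m./2] for odd [d]. *)
Lemma index_bound k : k < (d * m)./2 ->
  k %% m < m /\ (k %/ m < h \/ k %/ m = h /\ d = h.*2.+1 /\ k %% m < m./2).
Proof.
move=> kd; have m0 : 0 < m by lia.
split; first by rewrite ltn_mod.
have kE := divn_eq k m; have := ltn_pmod k m0; move: kE kd.
move: (k %/ m) (k %% m) => t i -> kd im.
have := odd_double_half d; case: (odd d) => dE; rewrite -dE in kd.
  have [|th] := ltnP t h; first by left.
  have tE : t = h by nia.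
  by right; split; [|split; [lia|nia]].
by left; nia.
Qed.

Lemma chord_endE k : k < (d * m)./2 ->
  chord_end k = let i := k %% m in let s := chord (k %/ m) in
    if i + s < m then i + s else i + s - m.
Proof.
move=> /index_bound[km _]; apply: modn_wrap.
by rewrite /chord; case: ifP; lia.
Qed.

Lemma inord_inj a b : a < m -> b < m -> inord a = inord b :> 'I_n.+1 -> a = b.
Proof. by move=> am bm /(congr1 val); rewrite /= !inordK //; lia. Qed.

(** Read in the same direction, equal edges have equal chords, and [h < m./2] makes the chord
    lengths distinct. Read in opposite directions, the chords would add up to [m], so both would be
    [m./2]; but these start below [m./2] and end at or above it. *)
Lemma circulant_edge_inj k k' : k < (d * m)./2 -> k' < (d * m)./2 ->
  circulant_edge k = circulant_edge k' -> k = k'.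
Proof.
move=> kd kd' /set2_eq E; rewrite (divn_eq k m) (divn_eq k' m).
have m0 : 0 < m by lia.
have km := ltn_pmod k m0; have km' := ltn_pmod k' m0.
have em : chord_end k < m by rewrite ltn_mod.
have em' : chord_end k' < m by rewrite ltn_mod.
have {}E : k %% m = k' %% m /\ chord_end k = chord_end k' \/
           k %% m = chord_end k' /\ chord_end k = k' %% m.
  by case: E => -[E1 E2]; [left|right]; split; apply: inord_inj.
move: E; rewrite !chord_endE //= /chord.
have [_ B] := index_bound kd; have [_ B'] := index_bound kd'.
move: (k %% m) (k' %% m) (k %/ m) (k' %/ m) km km' B B' => i i' t t'.
move=> im im' B B' E; suff : i = i' /\ t = t' by case=> -> ->.
move: E; case: (ltnP t h) => th; case: (ltnP t' h) => th'; do 2?case: ifP => ?.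
all: by lia.
Qed.

Lemma card_circulant : #|circulant| = (d * m)./2.
Proof.
rewrite card_imset ?card_ord // => k k' /circulant_edge_inj E.
by apply/val_inj/E.
Qed.

Lemma circulantP e : e \in circulant ->
  exists x y : 'I_n.+1, [/\ x != y, x < m, y < m & e = [set x; y]].
Proof.
case/imsetP=> -[k kd] _ -> /=; have m0 : 0 < m by lia.
exists (inord (k %% m)), (inord (chord_end k)).
have km := ltn_pmod k m0.
have em : chord_end k < m by rewrite ltn_mod.
rewrite !inordK; try lia.
split=> //; apply/eqP => /(inord_inj km em); rewrite chord_endE //= /chord.
by have := index_bound kd; do 2?case: ifP; lia.
Qed.

Lemma circulant_degree x : #|[set e in circulant | x \in e]| <= d.
Proof.
(* For [t < h], [t.*2.+1] gives the chord of index [t] starting at [x] and [t.*2] the one ending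
   there; for odd [d], [h.*2] gives the matching edge. *)
pose idx j := let t := j./2 in t * m +
  if t < h then if odd j then (x : nat) else (x + (m - t.+1)) %% m
  else if x < m./2 then (x : nat) else x - m./2.
have idxP k : k < (d * m)./2 -> x \in circulant_edge k ->
    exists2 j, j < d & idx j = k.
  move=> kd xk; have [km B] := index_bound kd; have m0 : 0 < m by lia.
  have em : chord_end k < m by rewrite ltn_mod.
  have xE : x = k %% m :> nat \/ x = chord_end k :> nat.
    by case/set2P: xk => ->; [left|right]; rewrite inordK //; lia.
  move: xE B; rewrite chord_endE //= /chord /idx.
  move: (divn_eq k m); move: (k %% m) (k %/ m) (x : nat) km.
  move=> i t y im -> [->|yE] [th|[tE [dE ih]]].
  - by exists t.*2.+1; [lia|rewrite /= uphalf_double th odd_double].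
  - by exists h.*2; [lia|rewrite doubleK ltnn ih tE].
  - rewrite th in yE; exists t.*2; first by lia.
    rewrite doubleK th odd_double modn_wrap; last by move: yE; case: ifP; lia.
    by move: yE; do 2?case: ifP; lia.
  - rewrite tE ltnn in yE *; exists h.*2; first by lia.
    by rewrite doubleK ltnn; move: yE; do 2?case: ifP; lia.
have /subset_leq_card/leq_trans : [set e in circulant | x \in e] \subset
    [set circulant_edge (idx (val j)) | j : 'I_d].
  apply/subsetP => _ /setIdP[/imsetP[[k kd] _ ->] /= /(idxP k kd)[j jd <-]].
  by apply/imsetP; exists (Ordinal jd).
by apply; rewrite -[leqRHS]card_ord; apply: leq_imset_card.
Qed.
End NearRegular.

(** * Double stars in complete graphs *)

(** The edges at [u] have distinct images by injectivity, hence distinct colours, all at [f u]. *)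
Lemma rainbow_star_size (G H : sgraph) (C : finType) (c : {set H} -> C)
    (f : {ffun G -> H}) (u : G) : is_copy f -> rainbow c f ->
  #|[set a | sedge u a]| <= #|colours_at (fun x y => c [set x; y]) (f u)|.
Proof.
move=> /andP[/injectiveP fI _] /forall_inP rf.
have fE a : f @: [set u; a] = [set f u; f a] by rewrite imsetU1 imset_set1.
have inj : {in [set a | sedge u a] &, injective (fun a => c [set f u; f a])}.
  move=> a b; rewrite !inE -!in_edges => ua ub /eqP.
  have /forall_inP/(_ _ ub)/implyP := rf _ ua.
  rewrite !fE => h /h /eqP E; have := set22 (f u) (f a).
  rewrite E => /set2P[] /fI // au.
  by move: ua; rewrite in_edges au sedge_irr.
rewrite -(card_in_imset inj); apply/subset_leq_card/subsetP => e /imsetP[a].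
rewrite inE => ua ->; apply: imset_f; rewrite inE.
by apply: contraTneq ua => /fI->; rewrite sedge_irr.
Qed.

Section Complete.
Variables (n : nat) (C : finType) (c : {set complete n} -> C).

Local Notation g := (fun x y : complete n => c [set x; y]).

Lemma image_edges : c @: edges (complete n) = all_colours g.
Proof.
apply/setP=> a; apply/imsetP/imset2P => [[e /imset2P[x y _ xy ->] ->]|].
  by exists x y => //; move: xy; rewrite !inE eq_sym.
move=> [x y _ yx ->]; exists [set x; y] => //.
by rewrite in_edges /= /complete_rel eq_sym.
Qed.

Lemma rainbow_double_star_copy p q :
  rainbow_double_star g p q -> has_rainbow_copy (double_star p q) c.
Proof.
move=> [x [y [s [t [ss st us uc]]]]].
(* Index 0 is the centre; the lists have [p + 1] and [q + 1] entries, so the defaults are never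
   reached. *)
pose f : {ffun double_star p q -> complete n} := [ffun u =>
  match u : ('I_p.+1 + 'I_q.+1)%type with
  | inl i => nth x (x :: s) i
  | inr j => nth y (y :: t) j
  end].
(* [E] lists the edges of the copy; injectivity of [c] on it is the rainbow condition. *)
pose E := [set x; y] :: [seq [set x; a] | a <- s] ++ [seq [set y; b] | b <- t].
have mx (i : star p) : i != ord0 -> f (inl i) \in s.
  by case: i => -[|i] // ip _; rewrite ffunE /=; apply: mem_nth; rewrite ss.
have my (i : star q) : i != ord0 -> f (inr i) \in t.
  by case: i => -[|i] // ip _; rewrite ffunE /=; apply: mem_nth; rewrite st.
have fx : f (inl ord0) = x by rewrite ffunE.
have fy : f (inr ord0) = y by rewrite ffunE.
have fE u v : sedge u v -> [set f u; f v] \in E.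
  have xE i : i != ord0 -> [set x; f (inl i)] \in E.
    move=> /mx si; rewrite inE mem_cat; apply/or3P/Or32.
    exact: (map_f (fun a => [set x; a])).
  have yE i : i != ord0 -> [set y; f (inr i)] \in E.
    move=> /my ti; rewrite inE mem_cat; apply/or3P/Or33.
    exact: (map_f (fun b => [set y; b])).
  case: u v => [i|i] [j|j] /=; rewrite /double_star_rel /= ?/star_rel.
  - have [->|i0] := eqVneq i ord0; first by rewrite fx => /xE.
    by move=> /eqP->; rewrite fx setUC xE.
  - by move=> /andP[/eqP-> /eqP->]; rewrite fx fy mem_head.
  - by move=> /andP[/eqP-> /eqP->]; rewrite fx fy setUC mem_head.
  - have [->|i0] := eqVneq i ord0; first by rewrite fy => /yE.
    by move=> /eqP->; rewrite fy setUC yE.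
have cI : {in E &, injective c}.
  have : uniq (map c E) by rewrite /= map_cat -!map_comp.
  elim: E {fE} => //= e E IH /andP[ce uE] a b.
  rewrite !inE => /predU1P[->|aE] /predU1P[->|bE] // cab.
  - by rewrite cab map_f in ce.
  - by rewrite -cab map_f in ce.
  - exact: IH.
have fI : injective f.
  have unx : uniq (x :: s).
    move: us; rewrite /= cat_uniq inE mem_cat !negb_or.
    by case/and3P=> /and3P[_ -> _] _ /and3P[].
  have uny : uniq (y :: t).
    move: us; rewrite /= cat_uniq mem_cat negb_or.
    by case/and3P=> _ /andP[_ ->] /and3P[].
  have dis z z' : z \in x :: s -> z' \in y :: t -> z != z'.
    move: us; have -> : uniq [:: x, y & s ++ t] = uniq ((x :: s) ++ (y :: t)).
      apply: perm_uniq; rewrite /= perm_cons perm_sym perm_catC /= perm_cons.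
      by rewrite perm_catC.
    rewrite cat_uniq => /and3P[_ /hasPn h _] zs /h.
    by apply: contraNneq => <-.
  have ms (i : 'I_p.+1) : nth x (x :: s) i \in x :: s.
    by apply: mem_nth; rewrite /= ss.
  have mt (i : 'I_q.+1) : nth y (y :: t) i \in y :: t.
    by apply: mem_nth; rewrite /= st.
  case=> [i|i] [j|j]; rewrite !ffunE => /eqP.
  - by rewrite nth_uniq //= ?ss // => /eqP/val_inj->.
  - by rewrite (negPf (dis _ _ (ms i) (mt j))).
  - by rewrite eq_sym (negPf (dis _ _ (ms j) (mt i))).
  - by rewrite nth_uniq //= ?st // => /eqP/val_inj->.
apply/existsP; exists f; apply/andP; split; [apply/andP; split|].
- exact/injectiveP.
- apply/forallP => u; apply/forallP => v; apply/implyP => uv.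
  rewrite /= /complete_rel; apply: contraTneq uv => /fI->.
  by rewrite sedge_irr.
- apply/forall_inP => _ /imset2P[u v _ uv ->].
  apply/forall_inP => _ /imset2P[u' v' _ uv' ->].
  rewrite !imsetU1 !imset_set1; apply/implyP => /eqP/cI ->//; exact: fE.
Qed.
End Complete.

Lemma double_star_degree_l p q :
  p < #|[set a | sedge (inl ord0 : double_star p q) a]|.
Proof.
(* [None] stands for the other centre, the neighbour besides the [p] leaves. *)
pose h (o : option 'I_p) : double_star p q :=
  if o is Some i then inl (lift ord0 i) else inr ord0.
have hI : injective h.
  by case=> [i|] [j|] //= [E]; congr Some; apply/val_inj; move: E => /=; lia.
apply: (@leq_trans #|h @: predT|).
  by rewrite card_imset // card_option card_ord.
apply/subset_leq_card/subsetP => _ /imsetP[o _ ->]; rewrite inE.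
by case: o.
Qed.

Lemma double_star_degree_r p q :
  q < #|[set a | sedge (inr ord0 : double_star p q) a]|.
Proof.
pose h (o : option 'I_q) : double_star p q :=
  if o is Some i then inr (lift ord0 i) else inl ord0.
have hI : injective h.
  by case=> [i|] [j|] //= [E]; congr Some; apply/val_inj; move: E => /=; lia.
apply: (@leq_trans #|h @: predT|).
  by rewrite card_imset // card_option card_ord.
apply/subset_leq_card/subsetP => _ /imsetP[o _ ->]; rewrite inE.
by case: o.
Qed.

(** * Colourings for the lower bound *)

Definition degree_in (T : finType) (H : {set {set T}}) x :=
  #|[set e in H | x \in e]|.

(** Edges of [H] are their own colours and all others get [None], which occurs as [H] is proper. A
    vertex sees at most its degree plus one colours, while the centres of a rainbow copy see at
    least [p + 1] and [q + 1]. *)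
Lemma ar_complete_gt n p q (H : {set {set complete n}}) :
  H \proper edges (complete n) ->
  (forall u v, u != v -> p <= degree_in H u -> degree_in H v < q) ->
  #|H| < ar (complete n) (double_star p q).
Proof.
move=> /properP[HE [e0 e0E e0H]] deg.
pose c e := if e \in H then Some e else None.
have colE x : #|colours_at (fun x y : complete n => c [set x; y]) x| <=
    (degree_in H x).+1.
  apply: leq_trans (_ : #|None |: Some @: [set e in H | x \in e]| <= _).
    apply/subset_leq_card/subsetP => _ /imsetP[y _ ->]; rewrite /c in_setU1.
    by case: ifP => // xyH; apply: imset_f; rewrite inE xyH set21.
  by rewrite cardsU1 -[(degree_in H x).+1]add1n leq_add ?leq_b1 ?leq_imset_card.
suff nr : ~~ has_rainbow_copy (double_star p q) c.
  apply: leq_trans (ar_max nr).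
  apply: leq_trans (_ : #|None |: Some @: H| <= _).
    rewrite cardsU1 card_imset; last by move=> ? ? [].
    by case: imsetP => [[]|].
  apply/subset_leq_card/subsetP => _ /setU1P[->|/imsetP[e eH ->]]; apply/imsetP.
    by exists e0; rewrite // /c (negPf e0H).
  by exists e; rewrite ?(subsetP HE) // /c eH.
apply/existsP => -[f /andP[fc fr]].
have /andP[/injectiveP fI _] := fc.
pose u : double_star p q := inl ord0; pose v : double_star p q := inr ord0.
have uv : f u != f v by apply: contraTneq isT => /fI.
have := leq_trans (double_star_degree_l p q) (rainbow_star_size u fc fr).
move=> /leq_trans/(_ (colE _)).
rewrite ltnS => /(deg _ _ uv).
have := leq_trans (double_star_degree_r p q) (rainbow_star_size v fc fr).
move=> /leq_trans/(_ (colE _)).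
by rewrite ltnS ltnNge => ->.
Qed.

Lemma proper_edges n (H : {set {set complete n}}) x :
  H \subset edges (complete n) -> degree_in H x + 1 < n ->
  H \proper edges (complete n).
Proof.
move=> HE dx; apply/properP; split=> //; apply/exists_inP.
apply: contraTT dx => /exists_inPn all_in; rewrite -leqNgt.
have inj : {in [set~ x] &, injective (fun y : complete n => [set x; y])}.
  move=> y z; rewrite !in_setC1 => yx _ E; have := set22 x y.
  by rewrite E => /set2P[] // yx'; rewrite yx' eqxx in yx.
have := card_in_imset inj; rewrite cardsC1 card_ord => cE.
suff : n.-1 <= degree_in H x by lia.
rewrite -cE; apply/subset_leq_card/subsetP => e /imsetP[y yx ->].
rewrite inE set21 andbT; apply: negbNE; apply: all_in.
by rewrite in_edges /= /complete_rel eq_sym -in_setC1.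
Qed.

(** No vertex of the circulant with [d = p - 1] has degree [p], so the degree condition holds
    vacuously. *)
Lemma lower_bound_off_diagonal n p q : 0 < q < p -> p + 2 <= n ->
  ((p - 1) * n)./2 < ar (complete n) (double_star p q).
Proof.
case: n => [|n] qp pn; first by lia.
pose H := circulant n n.+1 (p - 1).
have degH x : degree_in H x <= p - 1 by apply: circulant_degree; lia.
rewrite -(@card_circulant n n.+1 (p - 1)) //; last by lia.
apply: ar_complete_gt; last by move=> u v _ /leq_trans/(_ (degH u)); lia.
apply: (@proper_edges _ _ ord0); last first.
  by apply: (@leq_ltn_trans (p - 1 + 1)); [rewrite leq_add2r|lia].
apply/subsetP => e eH; have [||x [y [xy _ _ ->]]] := circulantP _ _ eH; try lia.
by rewrite in_edges.
Qed.

Lemma lower_bound_diagonal n p : 1 < p -> p + 2 <= n ->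
  (p * (n - 1))./2 < ar (complete n) (double_star p p).
Proof.
case: n => [|n] p1 pn; first by lia.
rewrite subn1 /=.
(* Of the [n.+1] vertices the circulant takes the first [n] and leaves [w] for the star [S], whose
   [n] edges raise [((p - 2) * n)./2] to [(p * n)./2]. Only [w] can reach degree [p]. *)
pose H := circulant n n (p - 2).
pose w : complete n.+1 := ord_max.
pose S := [set [set w; x] | x : complete n.+1 in [set~ w]].
have degH x : degree_in H x <= p - 2 by apply: circulant_degree; lia.
have HP (e : {set complete n.+1}) : e \in H ->
    w \notin e /\ e \in edges (complete n.+1).
  move=> eH; have [||x [y [xy xn yn ->]]] := circulantP _ _ eH; try lia.
  rewrite in_edges; split=> //; rewrite !inE -!val_eqE /=.
  by rewrite !gtn_eqF.
have cS : #|S| = n.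
  rewrite card_in_imset ?cardsC1 ?card_ord // => y z.
  rewrite !in_setC1 => yx _ E; have := set22 w y.
  by rewrite E => /set2P[] // yx'; rewrite yx' eqxx in yx.
have cHS : #|H :|: S| = (p * n)./2.
  rewrite cardsU (_ : H :&: S = set0) ?cards0.
    by rewrite card_circulant // ?cS; nia.
  apply/setP => e; rewrite !inE; apply/andP => -[/HP[we _] /imsetP[x _ E]].
  by rewrite E set21 in we.
have degU x : x != w -> degree_in (H :|: S) x <= p - 1.
  move=> xw; apply: leq_trans (_ : #|[set w; x] |: [set e in H | x \in e]| <= _).
    apply/subset_leq_card/subsetP => e; rewrite !inE.
    case/andP=> /orP[-> ->|/imsetP[y yw ->]]; first by rewrite orbT.
    by rewrite !inE (negPf xw) => /eqP->; rewrite eqxx.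
  by rewrite cardsU1; apply: leq_trans (leq_add (leq_b1 _) (degH x)) _; lia.
rewrite -cHS; apply: ar_complete_gt.
  apply: (@proper_edges _ _ ord0); last first.
    rewrite addn1 ltnS (leq_ltn_trans (degU _ _)) //; last by lia.
    by rewrite -val_eqE /=; lia.
  rewrite subUset; apply/andP; split; apply/subsetP => e; first by case/HP.
  by move=> /imsetP[x xw ->]; rewrite in_edges /= /complete_rel eq_sym -in_setC1.
move=> u v uv pu.
have uw : u = w.
  apply/eqP; apply: contraTT pu => /degU/leq_ltn_trans lt.
  by rewrite -ltnNge lt //; lia.
by rewrite uw eq_sym in uv; apply: leq_ltn_trans (degU v uv) _; lia.
Qed.

Theorem theorem11 (p q n : nat) (hp : 2 <= p) (hq : 1 <= q <= p)
    (hn : 6 * (p ^ 2 + 2 * p) <= n) :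
  ar (complete n) (double_star p q) =
    if q <= p - 1 then ((p - 1) * n) %/ 2 + 1 else (p * (n - 1)) %/ 2 + 1.
Proof.
have lower : (if q <= p - 1 then (p - 1) * n else p * (n - 1))./2 <
    ar (complete n) (double_star p q).
  case: ifP => qp; first by apply: lower_bound_off_diagonal; nia.
  have -> : q = p by lia.
  by apply: lower_bound_diagonal; nia.
have upper : 2 * ar (complete n) (double_star p q) <=
    (if q <= p - 1 then (p - 1) * n else p * (n - 1)) + 2.
  have [c nc <-] : exists2 c : {ffun {set complete n} -> {set complete n}},
      ~~ has_rainbow_copy (double_star p q) c &
      #|c @: edges (complete n)| = ar (complete n) (double_star p q).
    (* Without such a colouring [ar] would be an empty maximum, that is 0, against [lower]. *)
    have [c0 nc0|none] := pickP (fun c : {ffun {set complete n} ->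
      {set complete n}} => ~~ has_rainbow_copy (double_star p q) c).
      exact: ar_attained nc0.
    by move: lower; rewrite /ar big_pred0.
  rewrite image_edges.
  have := @upper_bound 'I_n _ (fun x y => c [set x; y]) _ p q hp hq.
  rewrite card_ord; apply=> // [x y|]; first by rewrite setUC.
  by move=> /rainbow_double_star_copy; apply/negP.
rewrite !divn2; case: ifP lower upper => _; lia.
Qed.
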